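(* Let $p\in\Delta_{m-1}$, $\theta\ge0$, and for $(u,X)\in\mathbb R^m\times\mathbb R^n$ let $$f_1(u,X)=\sum_{j=1}^m(p_j+u_j)g_j(X)+\iota_{\mathcal X}(X)+\tfrac12\theta\|u\|_2^2+\iota_{[0,\infty)^m}(p+u),\qquad \tilde f_1(u,X)=f_1(u,X)+\iota_{(-\infty,0]^m}(u),$$ with associated dual functions $\psi_1$ and $\tilde\psi_1$ on $\mathbb R^m$. Let $V=\min_{X\in\mathcal X}\varphi(X)$, where $\varphi(X)=\sum_{j=1}^mp_jg_j(X)+\iota_{\mathcal X}(X)$, and let $W=\sum_{j=1}^mp_j\min_{X\in\mathcal X}g_j(X)$. (i) For $\theta=0$ and for $\theta>0$, $\sup_{y\in\mathbb R^m}\tilde\psi_1(y)=V$ (strong duality holds for $\tilde f_1$). (ii) If $\theta=0$, then $\sup_{y\in\mathbb R^m}\psi_1(y)=W$, and the duality gap $V-W$ is nonnegative. The gap vanishes if and only if there exists $X^*\in\mathcal X$ such that $g_j(X^* )=\min_{X\in\mathcal X}g_j(X)$ for every $j$ with $p_j>0$. (iii) If $\theta>0$, then $\sup_{y\in\mathbb R^m}\psi_1(y)\in[W,V]$. Moreover $\sup_{y}\psi_1(y)=V$ whenever there exists $X^*\in\mathcal X$ with $g_j(X^* )=\min_{X\in\mathcal X}g_j(X)$ for every $j$ with $p_j>0$; in particular, the regularization introduces no new duality gap beyond that of the case $\theta=0$, i.e. $V-\sup_y\psi_1(y)\le V-W$.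
   Context: Scenario tree. Let $T,k\ge 1$ be integers and consider a finite rooted tree with levels $0,1,\dots,T+1$ (the history tree of a finitely supported discrete-time environment process), in which every node at a level $\le T$ has at least one child. For $0\le t\le T$, $I_t$ is the set of nodes at level $t$ ($I_0$ consists of the root), $n_t=|I_t|$, $N_T=\sum_{t=0}^T n_t$, $n=(k+1)N_T$. The terminal nodes (level $T+1$) are labeled $1,\dots,m$. For a node $i$, $i^-$ is its parent and $i^+$ its set of children. The terminal nodes are partitioned into original scenarios $I$ and added critical scenarios $\tilde I$ (all nodes at levels $\le T$ belong to the original tree). Market. Asset prices are $S_t(i)=(S_t^0,S_t^1(i),\dots,S_t^k(i))\in(0,\infty)^{k+1}$ for each node $i$ at level $t$; asset $0$ is risk-free (its price depends only on $t$). For $j\in\tilde I$ and $1\le i\le k$, $S^i_{T+1}(j)=\kappa_j^iS^i_T(j^-)$ with $\kappa_j^i>0$. The original market is arbitrage-free (no self-financing strategy with zero initial wealth has terminal wealth that is nonnegative a.s. and positive with positive probability). The claim is $G_0>0$ and $G_t(i)<0$ for $i\in I_t$, $1\le t\le T$. Probabilities. $\Delta_{m-1}=\{p\in\mathbb R^m_+:\sum_jp_j=1\}$; $p_j$ is the probability of terminal node $j$, with $p_j=0$ for $j\in\tilde I$. Strategies. $X\in\mathbb R^n$ is a family $X_t(i)\in\mathbb R^{k+1}$, $i\in I_t$, $0\le t\le T$. The (compact, convex) feasible set $\mathcal X$ consists of all $X$ with $X_t(i)\ge0$ componentwise for all $i\in I_t$, $0\le t\le T$; $\langle S_0,X_0\rangle\le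 G_0$; and $\langle S_t(i),X_t(i)-X_{t-1}(i^-)\rangle\le G_t(i)$ for all $i\in I_t$, $1\le t\le T$. The problem is assumed feasible: $\mathcal X\neq\emptyset$. Set $g_j(X)=-\langle S_{T+1}(j),X_T(j^-)\rangle$ for $j=1,\dots,m$. $\iota_C$ is the indicator function ($0$ on $C$, $+\infty$ off $C$). The dual function associated with $f:\mathbb R^m\times\mathbb R^n\to\overline{\mathbb R}$ is $\psi(y)=\inf_{(u,X)}\{f(u,X)-\langle y,u\rangle\}$. $W$ is called the wait-and-see value. *)

(* Defs.v *)
From HB Require Import structures.
From mathcomp Require Import all_boot all_order all_algebra.
From mathcomp Require Import all_classical all_reals all_analysis.

Set Implicit Arguments.
Unset Strict Implicit.
Unset Printing Implicit Defensive.

Import Order.TTheory GRing.Theory Num.Theory.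
Local Open Scope classical_set_scope.
Local Open Scope ring_scope.

(* The type [node] holds only the nodes of levels 0, ..., T; the terminal nodes
   (level T.+1) are the labels j : 'I_m, and the parent of j is [tparent j].
   The value of [parent] at the root is irrelevant. *)
Record scenario_tree (T m : nat) := ScenarioTree {
  node :> finType;
  level : node -> nat;
  tree_root : node;
  parent : node -> node;
  tparent : 'I_m -> node;
  level_le : forall i, (level i <= T)%N;
  level_eq0 : forall i, level i = 0%N <-> i = tree_root;
  level_parent : forall i, (0 < level i)%N -> level i = (level (parent i)).+1;
  level_tparent : forall j, level (tparent j) = T;
  has_child : forall i, (level i < T)%N ->
    exists i', (0 < level i')%N /\ parent i' = i;
  has_tchild : forall i, level i = T -> exists j, tparent j = i
}.

(* Asset 0 (index ord0) is risk-free; the risky asset i : 'I_k has index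
   [lift ord0 i].  The original scenarios are the j \notin critical, and only
   the values of [kappa] on [critical] matter. *)
Record market (R : realType) (k T m : nat) (tr : scenario_tree T m) := Market {
  price : tr -> 'rV[R]_k.+1;
  tprice : 'I_m -> 'rV[R]_k.+1;
  critical : {set 'I_m};
  kappa : 'I_m -> 'I_k -> R;
  price_gt0 : forall i a, 0 < price i 0 a;
  tprice_gt0 : forall j a, 0 < tprice j 0 a;
  price_riskfree : forall i i', level i = level i' ->
    price i 0 ord0 = price i' 0 ord0;
  tprice_riskfree : forall j j', tprice j 0 ord0 = tprice j' 0 ord0;
  kappa_gt0 : forall j a, j \in critical -> 0 < kappa j a;
  tprice_critical : forall j a, j \in critical ->
    tprice j 0 (lift ord0 a) = kappa j a * price (tparent tr j) 0 (lift ord0 a)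
}.

Definition dotp (R : realType) (d : nat) (x y : 'rV[R]_d) : R :=
  \sum_(i < d) x 0 i * y 0 i.

Definition simplex (R : realType) (m : nat) : set 'rV[R]_m :=
  [set p | (forall j, 0 <= p 0 j) /\ \sum_(j < m) p 0 j = 1].

Definition nonneg_orthant (R : realType) (m : nat) : set 'rV[R]_m :=
  [set v | forall j, 0 <= v 0 j].

Definition nonpos_orthant (R : realType) (m : nat) : set 'rV[R]_m :=
  [set v | forall j, v 0 j <= 0].

(* The indicator of convex analysis (the library's \1_C takes the values 1 and 0) *)
Definition cvx_indic (R : realType) (E : Type) (C : set E) (x : E) : \bar R :=
  if x \in C then 0%E else +oo%E.

Definition dual_function (R : realType) (m : nat) (E : Type)
    (f : 'rV[R]_m * E -> \bar R) (y : 'rV[R]_m) : \bar R :=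
  ereal_inf (range (fun z => (f z - (dotp y z.1)%:E)%E)).

(* Total version of the minimum, to be used together with [has_min] *)
Definition min_over (R : realType) (E : Type) (A : set E) (F : E -> \bar R) :
  \bar R := ereal_inf (F @` A).

Definition has_min (R : realType) (E : Type) (A : set E) (F : E -> \bar R) :=
  exists2 x, A x & F x = min_over A F.

Section Hedging.
Variables (R : realType) (k T m : nat) (tr : scenario_tree T m).
Variable M : market R k tr.

Definition strategy := tr -> 'rV[R]_k.+1.

Definition terminal_wealth (X : strategy) (j : 'I_m) : R :=
  dotp (tprice M j) (X (tparent tr j)).

Definition self_financing (X : strategy) :=
  forall i, (0 < level i)%N -> dotp (price M i) (X i - X (parent i)) = 0.

Definition original_prob (p : 'rV[R]_m) (P : pred 'I_m) : R :=
  \sum_(j < m | (j \notin critical M) && P j) p 0 j.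

Definition arbitrage (p : 'rV[R]_m) (X : strategy) :=
  [/\ self_financing X,
      dotp (price M (tree_root tr)) (X (tree_root tr)) = 0,
      original_prob p (fun j => 0 <= terminal_wealth X j) = 1 &
      0 < original_prob p (fun j => 0 < terminal_wealth X j)].

Definition arbitrage_free (p : 'rV[R]_m) := ~ exists X, arbitrage p X.

Variable G : tr -> R.

Definition feasible : set strategy :=
  [set X : strategy | [/\ forall i a, 0 <= X i 0 a,
      dotp (price M (tree_root tr)) (X (tree_root tr)) <= G (tree_root tr) &
      forall i, (0 < level i)%N ->
        dotp (price M i) (X i - X (parent i)) <= G i]].

Definition g (j : 'I_m) (X : strategy) : R := - terminal_wealth X j.

Definition phi (p : 'rV[R]_m) (X : strategy) : \bar R :=
  ((\sum_(j < m) p 0 j * g j X)%:E + cvx_indic R feasible X)%E.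

Definition f1 (p : 'rV[R]_m) (theta : R) (z : 'rV[R]_m * strategy) : \bar R :=
  let: (u, X) := z in
  ((\sum_(j < m) (p 0 j + u 0 j) * g j X)%:E
   + cvx_indic R feasible X
   + (2^-1 * theta * \sum_(j < m) u 0 j ^+ 2)%:E
   + cvx_indic R (@nonneg_orthant R m) (p + u)%R)%E.

Definition f1_tilde (p : 'rV[R]_m) (theta : R) (z : 'rV[R]_m * strategy) :
  \bar R := (f1 p theta z + cvx_indic R (@nonpos_orthant R m) z.1)%E.

Definition opt_value (p : 'rV[R]_m) : \bar R := min_over feasible (phi p).

Definition wait_and_see (p : 'rV[R]_m) : \bar R :=
  (\sum_(j < m) (p 0 j)%:E * min_over feasible (fun X => (g j X)%:E))%E.

Definition scenariowise_optimal (p : 'rV[R]_m) (X : strategy) :=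
  forall j, 0 < p 0 j -> (g j X)%:E = min_over feasible (fun Y => (g j Y)%:E).

End Hedging.

(* Main.v *)
(* Prices are positive and short positions are excluded, so the budget
   constraints bound the strategies level by level: the feasible set is compact,
   all minima are attained, and every cost g_j is nonpositive on it.

   Every dual value is at most V (take u = 0). For the modified problem y = 0
   already attains V, because u <= 0 and g_j <= 0 make the perturbation term
   nonnegative. For the unmodified problem let mu_j = min g_j. Writing
     sum_j (p_j + u_j) g_j - mu_j u_j
       = sum_j p_j mu_j + (p_j + u_j) (g_j - mu_j)
   gives psi_1(mu) >= W for every theta >= 0. If theta = 0 this is optimal: for
   y <= mu take u = -p, and if y_j > mu_j let u grow in the direction e_j. *)
Require Import Defs.
From HB Require Import structures.
From mathcomp Require Import all_boot all_order all_algebra.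
From mathcomp Require Import all_classical all_reals all_analysis.
From mathcomp Require Import ring.
Set Implicit Arguments.
Unset Strict Implicit.
Unset Printing Implicit Defensive.

Import Order.TTheory GRing.Theory Num.Theory.
Import numFieldNormedType.Exports.
Local Open Scope classical_set_scope.
Local Open Scope ring_scope.

(** * Linearity and continuity of the inner product; attained infima *)

Lemma dotpBr (R : realType) (d : nat) (x y z : 'rV[R]_d) :
  dotp x (y - z) = dotp x y - dotp x z.
Proof.
by rewrite /dotp -sumrB; apply: eq_bigr => i _; rewrite !mxE mulrBr.
Qed.

Lemma dotp_continuous (R : realType) (d : nat) (c : 'rV[R]_d) :
  continuous (dotp c).
Proof.
apply: (@continuous_big _ _ _ 0 xpredT); first exact: add_continuous.
move=> i _ x; apply: (cvgMl_tmp (FF := nbhs_filter x)).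
exact: (@coord_continuous R 1 d 0 i).
Qed.

Lemma min_attained (R : realType) (E : Type) (A : set E) (F : E -> \bar R) x :
  A x -> (forall y, A y -> (F x <= F y)%E) -> min_over A F = F x.
Proof.
move=> Ax xmin; apply/eqP; rewrite eq_le; apply/andP; split.
  by apply: ereal_inf_lbound; exists x.
by apply: le_ereal_inf_tmp => _ [y Ay <-]; exact: xmin.
Qed.

(** * Compactness of the feasible set and existence of minimizers *)

Section feasible_minimum.
Variables (R : realType) (k T m : nat) (tr : scenario_tree T m).
Variables (M : market R k tr) (G : tr -> R).

(** Every term of the inner product is nonnegative, so a single term is at most the whole. *)
Lemma holding_le (X : strategy R k tr) i a B :
  (forall b, 0 <= X i 0 b) -> dotp (price M i) (X i) <= B ->
  X i 0 a <= B / price M i 0 a.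
Proof.
move=> X0 leB; rewrite ler_pdivlMr ?price_gt0// mulrC; apply: le_trans leB.
rewrite /dotp (bigD1 a)//= lerDl sumr_ge0// => b _.
by rewrite mulr_ge0// ltW// price_gt0.
Qed.

(** Induction on the level: the holdings at the parent bound the wealth brought into [i], the budget
    constraint then bounds the wealth at [i], and [holding_le] turns this into a bound on each
    position. *)
Lemma feasible_node_bounded (i : tr) :
  exists B, forall X, feasible M G X -> forall a, X i 0 a <= B.
Proof.
have [n] := ubnP (level i); elim: n i => // n IH i lein.
suff [C HC] : exists C, forall X, feasible M G X ->
    dotp (price M i) (X i) <= C.
  exists (\big[Num.max/0]_a (C / price M i 0 a)) => X fX a.
  apply: le_trans (le_bigmax_cond _ _ _); last by [].
  by apply: holding_le (HC X fX); case: fX.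
have [li0|li0] := posnP (level i).
  exists (G (tree_root tr)) => X [_ hr _].
  by have /level_eq0 -> := li0.
have [|B HB] := IH (parent i); first by rewrite -ltnS -level_parent.
(* The inherited portfolio, revalued at the prices of [i], costs at most as much as holding [B]
   units of every asset. *)
exists (G i + dotp (price M i) (const_mx B)) => X fX.
have [_ _ /(_ i li0)] := fX; rewrite dotpBr lerBlDr => /le_trans; apply.
rewrite lerD2l ler_sum// => a _.
by rewrite mxE ler_wpM2l ?HB// ltW// price_gt0.
Qed.

(** Same functions as [strategy], now carrying the product topology, so that Tychonoff's theorem
    applies. *)
Let strategy_space := prod_topology (fun _ : tr => 'rV[R]_k.+1).

Lemma strategy_eval_continuous i : continuous (fun X : strategy_space => X i).
Proof. exact: (@proj_continuous _ (fun=> 'rV[R]_k.+1)). Qed.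

Lemma strategy_dotp_continuous c i :
  continuous (fun X : strategy_space => dotp c (X i)).
Proof.
move=> X; apply: (continuous_comp (@strategy_eval_continuous i X)).
exact: dotp_continuous.
Qed.

(** A closed subset of a product over the nodes of the boxes [[0, B i]], which is compact by
    Tychonoff. *)
Lemma feasible_compact : @compact strategy_space (feasible M G).
Proof.
have /choice[B HB] := feasible_node_bounded.
apply: (@subclosed_compact strategy_space _
    [set X : strategy_space | forall i, [set v : 'rV[R]_k.+1 |
       forall a, `[0, B i]%classic (v ord0 a)] (X i)]).
(* Feasibility becomes an intersection of preimages of closed half-lines under continuous maps; the
   [if] treats the root, the only node of level 0, together with the others. *)
- have -> : feasible M G =
     \bigcap_i ((\bigcap_a ((fun X : strategy_space => X i 0 a) @^-1`
                           [set x | 0 <= x])) `&`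
       ((fun X : strategy_space =>
           if (0 < level i)%N
           then dotp (price M i) (X i) - dotp (price M i) (X (parent i))
           else dotp (price M i) (X i)) @^-1` [set x | x <= G i])).
    apply/seteqP; split => X.
      move=> [X0 Xr Xs] i _; split; first by move=> a _; exact: X0.
      rewrite /preimage/=; case: posnP => [/level_eq0 -> //|li0].
      by rewrite -dotpBr; exact: Xs.
    move=> HX; split.
    + by move=> i a; have [/(_ a I)] := HX i I.
    + have [_] := HX (tree_root tr) I.
      by rewrite /preimage/=; have /level_eq0 -> := erefl (tree_root tr).
    + by move=> i li0; have [_] := HX i I; rewrite /preimage/= li0 dotpBr.
  apply: closed_bigI => i _; apply: closedI.
    apply: closed_bigI => a _; apply: preimage_closed; last exact: closed_ge.
    move=> X _; apply: (continuous_comp (g := fun v : 'rV_k.+1 => v 0 a)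
      (@strategy_eval_continuous i X)).
    exact: (@coord_continuous R 1 k.+1 0 a).
  apply: preimage_closed; last exact: closed_le.
  move=> X _; case: (0 < level i)%N; last exact: strategy_dotp_continuous.
  exact: (continuousB (@strategy_dotp_continuous (price M i) i X)
    (@strategy_dotp_continuous (price M i) (parent i) X)).
- apply: (@tychonoff _ (fun=> 'rV[R]_k.+1) (fun i =>
    [set v : 'rV[R]_k.+1 | forall a, `[0, B i]%classic (v ord0 a)])) => i.
  by apply: (@rV_compact _ _ (fun=> `[0, B i]%classic)) => _;
    exact: segment_compact.
- move=> X fX i a /=; rewrite in_itv/= (HB _ _ fX)// andbT.
  by case: fX.
Qed.

Lemma feasible_min (F : strategy R k tr -> R) :
  feasible M G !=set0 -> continuous (F : strategy_space -> R) ->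
  exists2 X, feasible M G X & forall Y, feasible M G Y -> F X <= F Y.
Proof.
move=> f0 Fc.
have [X XA Xmin] := @compact_EVT_min strategy_space R F _ f0 feasible_compact
  (continuous_subspaceT Fc).
by exists X => [|Y YA]; [rewrite inE in XA | apply: Xmin; rewrite inE].
Qed.

Lemma g_continuous j : continuous (g M j : strategy_space -> R).
Proof.
by move=> X; exact: (continuousN (@strategy_dotp_continuous _ _ X)).
Qed.

Lemma g_le0 j X : feasible M G X -> g M j X <= 0.
Proof.
case=> X0 _ _; rewrite oppr_le0 sumr_ge0// => a _.
by rewrite mulr_ge0// ltW// tprice_gt0.
Qed.

Lemma expected_cost_continuous (p : 'rV[R]_m) :
  continuous ((fun X => \sum_(j < m) p 0 j * g M j X) : strategy_space -> R).
Proof.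
apply: (@continuous_big _ _ _ 0 xpredT); first exact: add_continuous.
move=> j _ X; apply: (cvgMl_tmp (FF := nbhs_filter X)).
exact: g_continuous.
Qed.

End feasible_minimum.

(** * Bounds on the dual functions and weak duality *)

Section duality.
Variables (R : realType) (k T m : nat) (tr : scenario_tree T m).
Variables (M : market R k tr) (G : tr -> R) (p : 'rV[R]_m) (theta : R).

(** The finite part of the function minimized in [dual_function], valid where all indicators
    vanish. *)
Let lagrangian (y u : 'rV[R]_m) (X : strategy R k tr) : R :=
  \sum_(j < m) (p 0 j + u 0 j) * g M j X
  + 2^-1 * theta * \sum_(j < m) u 0 j ^+ 2 - dotp y u.

Lemma phi_feasible X : feasible M G X ->
  phi M G p X = (\sum_(j < m) p 0 j * g M j X)%:E.
Proof. by move=> fX; rewrite /phi /cvx_indic mem_set// adde0. Qed.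

Lemma f1_feasible (u : 'rV[R]_m) X : feasible M G X -> (forall j, 0 <= p 0 j + u 0 j) ->
  f1 M G p theta (u, X) = (\sum_(j < m) (p 0 j + u 0 j) * g M j X
    + 2^-1 * theta * \sum_(j < m) u 0 j ^+ 2)%:E.
Proof.
move=> fX pu; rewrite /f1 /cvx_indic (mem_set fX).
by rewrite mem_set ?adde0 // => j; rewrite mxE.
Qed.

(** One indicator is infinite and no summand is [-oo], so nothing cancels it. *)
Lemma f1_infeasible (u : 'rV[R]_m) X :
  ~ (feasible M G X /\ forall j, 0 <= p 0 j + u 0 j) ->
  f1 M G p theta (u, X) = +oo%E.
Proof.
move=> h; rewrite /f1 /cvx_indic.
case: ifPn => fX; case: ifPn => pu; rewrite ?adde0 ?addey ?addye//.
exfalso; apply: h; split; first by rewrite inE in fX.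
by move=> j; move: pu; rewrite inE => /(_ j); rewrite mxE.
Qed.

Lemma f1_le_f1_tilde z : (f1 M G p theta z <= f1_tilde M G p theta z)%E.
Proof.
by rewrite /f1_tilde leeDl// /cvx_indic; case: ifP => _ //; exact: leey.
Qed.

Lemma dual_f1_le y (u : 'rV[R]_m) X : feasible M G X -> (forall j, 0 <= p 0 j + u 0 j) ->
  (dual_function (f1 M G p theta) y <= (lagrangian y u X)%:E)%E.
Proof.
move=> fX pu; apply: ereal_inf_lbound; exists (u, X) => //.
by rewrite f1_feasible.
Qed.

Lemma dual_f1_ge y c :
  (forall (u : 'rV[R]_m) X, feasible M G X -> (forall j, 0 <= p 0 j + u 0 j) ->
    c <= lagrangian y u X) ->
  (c%:E <= dual_function (f1 M G p theta) y)%E.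
Proof.
move=> h; apply: le_ereal_inf_tmp => _ [[u X] _ <-].
have [[fX pu]|H] := pselect (feasible M G X /\ forall j, 0 <= p 0 j + u 0 j).
  by rewrite f1_feasible// lee_fin; exact: h.
by rewrite f1_infeasible// addye// leey.
Qed.

Lemma dual_f1_tilde_ge y c :
  (forall (u : 'rV[R]_m) X, feasible M G X -> (forall j, 0 <= p 0 j + u 0 j) ->
    (forall j, u 0 j <= 0) -> c <= lagrangian y u X) ->
  (c%:E <= dual_function (f1_tilde M G p theta) y)%E.
Proof.
move=> h; apply: le_ereal_inf_tmp => _ [[u X] _ <-].
rewrite /f1_tilde /cvx_indic /=.
have [[fX pu]|H] := pselect (feasible M G X /\ forall j, 0 <= p 0 j + u 0 j).
  rewrite -/(f1 M G p theta (u, X)) f1_feasible//; case: ifPn => [|_].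
    by rewrite inE adde0 lee_fin => u0; exact: h.
  by rewrite addey// addye// leey.
rewrite -/(f1 M G p theta (u, X)) f1_infeasible// addye ?addye ?leey//.
by case: ifP.
Qed.

(** The extra indicator is nonnegative, and infima are monotone. *)
Lemma dual_f1_le_tilde y :
  (dual_function (f1 M G p theta) y
   <= dual_function (f1_tilde M G p theta) y)%E.
Proof.
apply: le_ereal_inf_tmp => _ [z _ <-].
by apply: le_trans (leeB (f1_le_f1_tilde z) (lexx _)); apply: ereal_inf_lbound;
  exists z.
Qed.

Hypothesis p_ge0 : forall j, 0 <= p 0 j.

Lemma dual_f1_tilde_le y X : feasible M G X ->
  (dual_function (f1_tilde M G p theta) y <= phi M G p X)%E.
Proof.
move=> fX; apply: ereal_inf_lbound; exists (0, X) => //.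
rewrite /f1_tilde f1_feasible//=.
  rewrite phi_feasible// /cvx_indic mem_set => [|j]; last by rewrite mxE.
  rewrite adde0 -EFinB; congr _%:E.
  rewrite [dotp _ _]big1 => [|j _]; last by rewrite mxE mulr0.
  rewrite [X in _ * _ * X]big1 => [|j _]; last by rewrite mxE expr0n.
  by rewrite mulr0 addr0 subr0; apply: eq_bigr => j _; rewrite mxE addr0.
by move=> j; rewrite mxE addr0.
Qed.

Lemma weak_duality_tilde :
  (ereal_sup (range (dual_function (f1_tilde M G p theta)))
     <= opt_value M G p)%E.
Proof.
apply: ge_ereal_sup => _ [y _ <-].
by apply: le_ereal_inf_tmp => _ [X fX <-]; exact: dual_f1_tilde_le.
Qed.

End duality.

(** * Strong duality, the wait-and-see gap and the effect of regularization *)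

Unset Implicit Arguments.
Set Strict Implicit.

Theorem theorem4p6 (R : realType) (T k m : nat) (hT : (1 <= T)%N) (hk : (1 <= k)%N)
    (tr : scenario_tree T m) (M : market R k tr) (G : tr -> R)
    (p : 'rV[R]_m) (theta : R)
    (hG0 : 0 < G (tree_root tr))
    (hG : forall i : tr, (0 < level i)%N -> G i < 0)
    (hp : simplex p)
    (hpcrit : forall j, j \in critical M -> p 0 j = 0)
    (harb : arbitrage_free M p)
    (hfeas : feasible M G !=set0)
    (htheta : 0 <= theta) :
  let V := opt_value M G p in
  let W := wait_and_see M G p in
  let sup_psi := ereal_sup (range (dual_function (f1 M G p theta))) in
  let sup_psi_tilde := ereal_sup (range (dual_function (f1_tilde M G p theta))) in
  (* the minima defining V and W are attained *)
  (has_min (feasible M G) (phi M G p) /\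
   forall j, has_min (feasible M G) (fun X => (g M j X)%:E)) /\
  (* (i) *)
  sup_psi_tilde = V /\
  (* (ii) *)
  (theta = 0 ->
    [/\ sup_psi = W, (0 <= V - W)%E &
        (V - W = 0)%E <->
        exists2 X, feasible M G X & scenariowise_optimal M G p X]) /\
  (* (iii) *)
  (0 < theta ->
    [/\ (W <= sup_psi <= V)%E,
        (exists2 X, feasible M G X & scenariowise_optimal M G p X) ->
          sup_psi = V &
        (V - sup_psi <= V - W)%E]).
Proof.
have [p_ge0 _] := hp; move=> V W sup_psi sup_psi_tilde.
have [Xs fXs Xs_min] := feasible_min hfeas (@expected_cost_continuous _ _ _ _ _ M p).
pose v : R := \sum_(j < m) p 0 j * g M j Xs.
have hasV : has_min (feasible M G) (phi M G p).
  exists Xs => //; symmetry; apply: min_attained => // Y fY.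
  by rewrite !phi_feasible// lee_fin; exact: Xs_min.
have VE : V = v%:E.
  rewrite -(phi_feasible _ fXs); apply: min_attained => // Y fY.
  by rewrite !phi_feasible// lee_fin; exact: Xs_min.
have /choice[xs xsP] : forall j, exists X, feasible M G X /\
    forall Y, feasible M G Y -> g M j X <= g M j Y.
  move=> j; have [X fX X_min] := feasible_min hfeas (@g_continuous _ _ _ _ _ M j).
  by exists X.
pose mu : 'rV[R]_m := \row_j g M j (xs j).
have mu_le j X : feasible M G X -> mu 0 j <= g M j X.
  by move=> fX; rewrite mxE; apply (xsP j).2.
have muE j : min_over (feasible M G) (fun X => (g M j X)%:E) = (mu 0 j)%:E.
  rewrite mxE; apply: (min_attained (F := fun X => (g M j X)%:E)).
    exact: (xsP j).1.
  by move=> Y fY; rewrite lee_fin; apply (xsP j).2.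
pose w : R := \sum_(j < m) p 0 j * mu 0 j.
have WE : W = w%:E.
  by rewrite -sumEFin; apply: eq_bigr => j _; rewrite muE.
have w_le X : feasible M G X -> w <= \sum_(j < m) p 0 j * g M j X.
  by move=> fX; apply: ler_sum => j _; rewrite ler_wpM2l// mu_le.
(* The terms [p_j (g_j - mu_j)] are nonnegative, so their sum vanishes only if each does; this says
   nothing where [p_j = 0], exactly as in [scenariowise_optimal]. *)
have optE X : feasible M G X ->
    scenariowise_optimal M G p X <-> \sum_(j < m) p 0 j * g M j X = w.
  move=> fX; split=> [opt|/eqP].
    apply: eq_bigr => j _; have := p_ge0 j; rewrite le_eqVlt.
    case/predU1P => [<-|/opt]; first by rewrite !mul0r.
    by rewrite muE => -[->].
  rewrite -subr_eq0 -sumrB psumr_eq0 => [/allP h j pj|j _]; last first.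
    by rewrite -mulrBr mulr_ge0// subr_ge0 mu_le.
  have := h j (mem_index_enum _); rewrite -mulrBr mulf_eq0 gt_eqF//= subr_eq0.
  by move/eqP->; rewrite muE.
have V_le_optimal X : feasible M G X -> scenariowise_optimal M G p X -> v <= w.
  by move=> fX /(optE X fX) <-; exact: Xs_min.
have sup_tildeE : sup_psi_tilde = V.
  apply/eqP; rewrite eq_le weak_duality_tilde//=; apply: le_ereal_sup_tmp.
  exists (dual_function (f1_tilde M G p theta) 0); first by exists 0.
  rewrite VE; apply: dual_f1_tilde_ge => u X fX pu u0.
  rewrite [dotp _ _]big1 => [|j _]; last by rewrite mxE mul0r.
  rewrite subr0 (le_trans (Xs_min _ fX))// -[leLHS]addr0 lerD//.
    apply: ler_sum => j _; rewrite mulrDl lerDl.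
    by rewrite mulr_le0 ?(g_le0 j fX).
  by rewrite !mulr_ge0// sumr_ge0// => j _; rewrite sqr_ge0.
have W_le_sup : (W <= sup_psi)%E.
  apply: le_ereal_sup_tmp.
  exists (dual_function (f1 M G p theta) mu); first by exists mu.
  rewrite WE; apply: dual_f1_ge => u X fX pu.
  (* The quadratic term is moved last, to be dropped at the end as nonnegative. *)
  rewrite addrAC -sumrB -[leLHS]addr0 lerD//.
    apply: ler_sum => j _.
    have -> : (p 0 j + u 0 j) * g M j X - mu 0 j * u 0 j
      = p 0 j * mu 0 j + (p 0 j + u 0 j) * (g M j X - mu 0 j) by ring.
    by rewrite lerDl mulr_ge0 ?subr_ge0 ?mu_le.
  by rewrite !mulr_ge0// sumr_ge0// => j _; rewrite sqr_ge0.
have sup_le_V : (sup_psi <= V)%E.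
  rewrite -sup_tildeE; apply: ge_ereal_sup => _ [y _ <-].
  apply: le_trans (dual_f1_le_tilde _ _ _ _ _) _.
  by apply: ereal_sup_ubound; exists y.
have wv : w <= v by exact: w_le.
split; first by split=> // j; exists (xs j); rewrite ?muE ?mxE//; apply (xsP j).1.
split; first by [].
split=> [theta0|theta_gt0].
- split.
  + apply/eqP; rewrite eq_le W_le_sup andbT.
    apply: ge_ereal_sup => _ [y _ <-]; rewrite WE.
    have [y_le|/existsNP[j /negP]] :=
        pselect (forall j, y 0 j <= mu 0 j).
      (* With [u = -p] all cost coefficients vanish, so any feasible [X] serves and what remains is
         the inner product of [y] and [p], at most [w]. *)
      have [X fX] := hfeas.
      apply: le_trans (dual_f1_le (u := - p) theta y fX _) _ => [j|].
        by rewrite mxE subrr.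
      rewrite lee_fin theta0 mulr0 mul0r addr0 big1 => [|j _]; last first.
        by rewrite mxE subrr mul0r.
      rewrite sub0r /dotp -sumrN; apply: ler_sum => j _.
      by rewrite mxE mulrN opprK mulrC ler_wpM2l.
    (* Taking [X = xs j] gives [g_j = mu_j], so along [u = t e_j] the Lagrangian is affine in [t]
       with slope [mu_j - y_j < 0]. *)
    rewrite -ltNge => mu_lt.
    have fX := (xsP j).1.
    (* This multiple of the j-th unit vector makes the Lagrangian equal to w. *)
    pose t := (\sum_(i < m) p 0 i * g M i (xs j) - w) / (y 0 j - mu 0 j).
    have t0 : 0 <= t by rewrite divr_ge0 ?subr_ge0 ?w_le// ltW.
    have u_ge0 i : 0 <= (t *: delta_mx 0 j : 'rV[R]_m) 0 i.
      by rewrite !mxE mulr_ge0.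
    apply: le_trans (dual_f1_le (u := t *: delta_mx 0 j) theta y fX _) _.
      by move=> i; rewrite addr_ge0.
    have sumE (F : 'I_m -> R) :
        \sum_i F i * (t *: delta_mx 0 j : 'rV[R]_m) 0 i = F j * t.
      rewrite (bigD1 j)//= big1 => [|i ij].
        by rewrite !mxE !eqxx mulr1 addr0.
      by rewrite !mxE (negPf ij) andbF !mulr0.
    rewrite lee_fin theta0 mulr0 mul0r addr0 /dotp sumE.
    under eq_bigr do rewrite mulrDl [X in _ + X]mulrC.
    rewrite big_split/= sumE -addrA -mulrBl.
    have -> : g M j (xs j) = mu 0 j by rewrite mxE.
    (* The strict inequality [mu_lt] makes the denominator of [t] nonzero, so it cancels against the
       slope. *)
    rewrite -opprB mulNr mulrC divfK ?subr_eq0 ?gt_eqF//.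
    by rewrite opprB addrC subrK.
  + by rewrite VE WE -EFinB lee_fin subr_ge0.
  + rewrite VE WE -EFinB; split=> [[/subr0_eq vw]|[X fX opt]].
      (* When [v = w], the minimizer of the expected cost is itself optimal in every scenario of
         positive probability. *)
      by exists Xs => //; apply/optE.
    congr _%:E; apply/eqP; rewrite subr_eq0 eq_le wv andbT.
    exact: V_le_optimal opt.
- split; first by rewrite W_le_sup.
  + move=> [X fX opt]; apply/eqP; rewrite eq_le sup_le_V/=.
    apply: le_trans W_le_sup; rewrite VE WE lee_fin.
    exact: V_le_optimal opt.
  + exact: leeB.
Qed.
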